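(* Let $\lambda\in(0,1]$ and $-1\le B<0$. Then $v_\lambda(0,B,z)=\dfrac{1}{(1+Bz)^{\lambda}}$ is a stable function, i.e. it is stable with respect to itself.
   Context: $\mathbb{D}=\{z\in\mathbb{C}:|z|<1\}$, $\mathbb{N}=\{1,2,3,\dots\}$, and $\mathcal{A}_1$ is the class of analytic functions $f$ in $\mathbb{D}$ with $f(0)=1$. Powers are principal branches (value $1$ at $z=0$). For $f(z)=\sum_{k=0}^\infty a_kz^k$, the $n$-th partial sum is $s_n(f(z))=\sum_{k=0}^n a_kz^k$. For $f,g$ analytic in $\mathbb{D}$, $f\prec g$ ($f$ is subordinate to $g$) means there is an analytic $\omega:\mathbb{D}\to\mathbb{C}$ with $\omega(0)=0$ and $|\omega(z)|<1$ for all $z\in\mathbb{D}$ such that $f=g\circ\omega$. For $n\in\mathbb{N}$, $F\in\mathcal{A}_1$ is $n$-stable with respect to $G\in\mathcal{A}_1$ if $\frac{s_n(F(z))}{F(z)}\prec\frac{1}{G(z)}$ in $\mathbb{D}$; $F$ is stable with respect to $G$ if it is $n$-stable with respect to $G$ for every $n\in\mathbb{N}$; $F$ is called stable if it is stable with respect to itself. *)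

(* Defs.v *)
From Stdlib Require Import Reals.
From Coquelicot Require Import Coquelicot.
Open Scope R_scope.

Definition in_disc (z : C) : Prop := Cmod z < 1.

(* Functions on the disc are total functions [C -> C]; only their values on
   the disc are ever constrained. *)
Definition analytic_on_disc (f : C -> C) : Prop :=
  forall z : C, in_disc z -> @ex_derive C_AbsRing C_NormedModule f z.

Definition class_A1 (f : C -> C) : Prop :=
  analytic_on_disc f /\ f (RtoC 0) = RtoC 1.

(* Principal argument, in (-PI, PI]; only meaningful for w <> 0. *)
Definition Carg (w : C) : R :=
  if Rle_dec 0 (Im w) then acos (Re w / Cmod w) else - acos (Re w / Cmod w).

Definition Clog (w : C) : C := (ln (Cmod w), Carg w).

Definition Cexp (z : C) : C := (exp (Re z) * cos (Im z), exp (Re z) * sin (Im z)).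

(* Principal branch of w ^ s for a real exponent s; only meaningful for w <> 0.
   It takes the value 1 at w = 1. *)
Definition Cpower (w : C) (s : R) : C := Cexp (Cmult (RtoC s) (Clog w)).

Definition power_series_on_disc (f : C -> C) (a : nat -> C) : Prop :=
  forall z : C, in_disc z -> @is_pseries C_AbsRing C_NormedModule a z (f z).

(* [sum_n] runs over k = 0, ..., n inclusive. *)
Definition partial_sum (a : nat -> C) (n : nat) (z : C) : C :=
  sum_n (fun k : nat => Cmult (a k) (Cpow z k)) n.

(* Subordination is a relation between functions analytic in the disc, so
   analyticity of f and g is part of it; in particular a quotient with a pole
   in the disc is rejected although division is total. *)
Definition subordinate (f g : C -> C) : Prop :=
  analytic_on_disc f /\ analytic_on_disc g /\
  exists omega : C -> C,
    analytic_on_disc omega /\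
    omega (RtoC 0) = RtoC 0 /\
    (forall z : C, in_disc z -> Cmod (omega z) < 1) /\
    (forall z : C, in_disc z -> f z = g (omega z)).

(* The coefficient sequence a of F is unique, so the existential quantifier
   over a merely names it. *)
Definition n_stable_wrt (n : nat) (F G : C -> C) : Prop :=
  class_A1 F /\ class_A1 G /\
  exists a : nat -> C,
    power_series_on_disc F a /\
    subordinate (fun z : C => Cdiv (partial_sum a n z) (F z))
                (fun z : C => Cinv (G z)).

Definition stable_wrt (F G : C -> C) : Prop :=
  forall n : nat, (1 <= n)%nat -> n_stable_wrt n F G.

Definition stable (F : C -> C) : Prop := stable_wrt F F.

(* The case A = 0 of the family v_lambda(A, B, z). *)
Definition v0 (lambda B : R) (z : C) : C :=
  Cinv (Cpower (Cplus (RtoC 1) (Cmult (RtoC B) z)) lambda).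

(* Main.v *)
(** With [b = - B] and [u = b z] everything reduces to [F u = (1 - u)^(- lam)], whose coefficients
    [c_k] are positive and decrease for [lam <= 1].  Let [s] be the [n]-th partial sum.
    By Enestrom-Kakeya [(1 - u) s u] stays in the disc of radius [1] about [1], so [s] has an
    analytic logarithm and [s u (1 - u)^lam = (1 - Omega u)^lam] where
    [Omega u = 1 - (1 - u) (s u)^(1/lam)].  Since [(1 - u) s' = lam s - (lam + n) c_n u^n],
    [Omega' u = (1/lam) (lam + n) c_n u^n (s u)^(1/lam - 1)].  As [1/lam - 1 >= 0] and
    [|s u| <= s |u|], this gives [|Omega' u| <= Omega' |u|], hence
    [|Omega u| <= Omega |u| = 1 - (1 - |u|) (s |u|)^(1/lam) <= |u|], and [Omega (b z) / b] is the
    required Schwarz function.  The same differential identity bounds the derivative of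
    [s u (1 - u)^lam] by a multiple of [(n + 1) |u|^n], so the partial sums converge to [F]. *)

Require Import Defs.
From Stdlib Require Import Reals Lra.
From Coquelicot Require Import Coquelicot.
Open Scope R_scope.

(** * Complex differentiation *)

Notation Cderiv f z l :=
  (@is_derive C_AbsRing (AbsRing_NormedModule C_AbsRing) f z l).

Lemma Cderiv_iff (f : C -> C) (z l : C) :
  Cderiv f z l <->
  forall eps, 0 < eps -> exists d, 0 < d /\ forall w, Cmod (w - z) < d ->
    Cmod (f w - f z - (w - z) * l) <= eps * Cmod (w - z).
Proof.
  split.
  - intros [_ H] eps Heps.
    destruct (H z (fun P HP => HP) (mkposreal eps Heps)) as [d Hd].
    exists d. split; [apply cond_pos|]. exact Hd.
  - intros H. split; [apply is_linear_scal_l|].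
    intros x Hx.
    (* Differentiability is tested at every limit of the filter [locally z], and [z] is the only
       one. *)
    apply (@is_filter_lim_locally_unique C_AbsRing (AbsRing_NormedModule C_AbsRing)) in Hx. subst x.
    intros eps. destruct (H eps (cond_pos eps)) as [d [Hd Hw]].
    exists (mkposreal d Hd). exact Hw.
Qed.

(** [analytic_on_disc] refers to [C_NormedModule], the calculus rules to
    [AbsRing_NormedModule C_AbsRing]. Both carry the norm [Cmod], so the epsilon-delta form passes
    from one to the other. *)
Lemma Cderiv_ex_derive (f : C -> C) (z l : C) :
  Cderiv f z l -> @ex_derive C_AbsRing C_NormedModule f z.
Proof.
  intros H. exists l. split; [apply is_linear_scal_l|].
  intros x Hx.
  apply (@is_filter_lim_locally_unique C_AbsRing (AbsRing_NormedModule C_AbsRing)) in Hx. subst x.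
  intros eps.
  destruct (proj1 (Cderiv_iff f z l) H eps (cond_pos eps)) as [d [Hd Hw]].
  exists (mkposreal d Hd). exact Hw.
Qed.

Lemma Cderiv_eq (f : C -> C) (z l l' : C) : Cderiv f z l -> l = l' -> Cderiv f z l'.
Proof. now intros H <-. Qed.

Lemma Cderiv_id (z : C) : Cderiv (fun w => w) z (RtoC 1).
Proof. apply (is_derive_id (K := C_AbsRing) z). Qed.

Lemma Cderiv_const (a z : C) : Cderiv (fun _ => a) z (RtoC 0).
Proof. apply (is_derive_const (V := AbsRing_NormedModule C_AbsRing)). Qed.

Lemma Cderiv_plus (f g : C -> C) (z df dg : C) :
  Cderiv f z df -> Cderiv g z dg -> Cderiv (fun w => f w + g w)%C z (df + dg)%C.
Proof. apply (is_derive_plus (V := AbsRing_NormedModule C_AbsRing) f g). Qed.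

Lemma Cderiv_minus (f g : C -> C) (z df dg : C) :
  Cderiv f z df -> Cderiv g z dg -> Cderiv (fun w => f w - g w)%C z (df - dg)%C.
Proof. apply (is_derive_minus (V := AbsRing_NormedModule C_AbsRing) f g). Qed.

Lemma Cderiv_mult (f g : C -> C) (z df dg : C) :
  Cderiv f z df -> Cderiv g z dg ->
  Cderiv (fun w => f w * g w)%C z (df * g z + f z * dg)%C.
Proof.
  intros Hf Hg. apply (is_derive_mult (K := C_AbsRing) f g); auto. apply Cmult_comm.
Qed.

Lemma Cderiv_scal (a : C) (f : C -> C) (z df : C) :
  Cderiv f z df -> Cderiv (fun w => a * f w)%C z (a * df)%C.
Proof.
  intros Hf. eapply Cderiv_eq.
  - apply Cderiv_mult; [apply Cderiv_const | exact Hf].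
  - cbv beta; ring.
Qed.

Lemma Cderiv_comp (f g : C -> C) (z df dg : C) :
  Cderiv f (g z) df -> Cderiv g z dg -> Cderiv (fun w => f (g w)) z (dg * df)%C.
Proof. apply (is_derive_comp (K := C_AbsRing) (V := AbsRing_NormedModule C_AbsRing) f g). Qed.

(** * The complex exponential *)

Lemma Cmod_le_sum (z : C) : Cmod z <= Rabs (Re z) + Rabs (Im z).
Proof.
  replace z with (RtoC (Re z) + Ci * RtoC (Im z))%C at 1.
  - eapply Rle_trans; [apply Cmod_triangle|].
    rewrite Cmod_mult, Cmod_Ci, !Cmod_R. lra.
  - destruct z as [x y]. apply injective_projections; simpl; ring.
Qed.

Lemma Rabs_Im_le_Cmod (z : C) : Rabs (Im z) <= Cmod z.
Proof. eapply Rle_trans; [apply Rmax_r | apply Rmax_Cmod]. Qed.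

Lemma Cexp_plus (z w : C) : Cexp (z + w) = (Cexp z * Cexp w)%C.
Proof.
  unfold Cexp. rewrite re_plus, im_plus, exp_plus, cos_plus, sin_plus.
  apply injective_projections; simpl; ring.
Qed.

Lemma Cexp_RtoC (x : R) : Cexp (RtoC x) = RtoC (exp x).
Proof.
  unfold Cexp, RtoC; simpl. rewrite cos_0, sin_0, Rmult_1_r, Rmult_0_r. reflexivity.
Qed.

Lemma Cexp_0 : Cexp (RtoC 0) = RtoC 1.
Proof. now rewrite Cexp_RtoC, exp_0. Qed.

Lemma Cmod_Cexp (z : C) : Cmod (Cexp z) = exp (Re z).
Proof.
  unfold Cmod, Cexp; simpl.
  assert (H := sin2_cos2 (Im z)). unfold Rsqr in H.
  replace (_ + _) with (Rsqr (exp (Re z)))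
    by (unfold Rsqr; transitivity (exp (Re z) * exp (Re z) *
          (sin (Im z) * sin (Im z) + cos (Im z) * cos (Im z))); [rewrite H|]; ring).
  apply sqrt_Rsqr. left. apply exp_pos.
Qed.

Lemma Cexp_nz (z : C) : Cexp z <> RtoC 0.
Proof. apply Cmod_gt_0. rewrite Cmod_Cexp. apply exp_pos. Qed.

Lemma Cinv_Cexp (z : C) : Cinv (Cexp z) = Cexp (- z).
Proof.
  assert (H : (Cexp (- z) * Cexp z)%C = RtoC 1).
  { rewrite <- Cexp_plus. replace (- z + z)%C with (RtoC 0) by ring. apply Cexp_0. }
  rewrite <- (Cmult_1_l (/ Cexp z)), <- H. field. apply Cexp_nz.
Qed.

(** Clearing the denominator admits [x = 0]: either coordinate of a nonzero complex increment may
    vanish. *)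
Lemma real_deriv_at_0 (f : R -> R) (l eps : R) :
  derivable_pt_lim f 0 l -> 0 < eps ->
  exists d, 0 < d /\ forall x, Rabs x < d -> Rabs (f x - f 0 - x * l) <= eps * Rabs x.
Proof.
  intros H Heps. destruct (H eps Heps) as [d Hd].
  exists d. split; [apply cond_pos|]. intros x Hx.
  destruct (Req_dec x 0) as [->|Hx0].
  - rewrite Rabs_R0. replace (f 0 - f 0 - 0 * l) with 0 by ring. rewrite Rabs_R0. lra.
  - specialize (Hd x Hx0 Hx). rewrite Rplus_0_l in Hd.
    replace (f x - f 0 - x * l) with (((f x - f 0) / x - l) * x) by now field.
    rewrite Rabs_mult. apply Rmult_le_compat_r; [apply Rabs_pos | lra].
Qed.

(** The addition formula moves the question to [0], where the first-order expansions of [exp], [cos]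
    and [sin] are combined. *)
Lemma Cderiv_Cexp (z : C) : Cderiv Cexp z (Cexp z).
Proof.
  apply Cderiv_iff. intros eps Heps.
  set (M := exp (Re z)). assert (HM : 0 < M) by apply exp_pos.
  (* The errors below add up to [M * (9 * e * r)], hence the [10 * M]; [e <= 1] keeps [exp x] below
     [3]. *)
  set (e := Rmin 1 (eps / (10 * M))).
  assert (He : 0 < e) by (apply Rmin_glb_lt; [lra | apply Rdiv_lt_0_compat; lra]).
  assert (He1 : e <= 1) by apply Rmin_l.
  assert (He2 : M * (10 * e) <= eps).
  { assert (H := Rmin_r 1 (eps / (10 * M))). fold e in H.
    apply Rmult_le_compat_l with (r := 10 * M) in H; [|lra].
    replace (10 * M * (eps / (10 * M))) with eps in H by (field; lra). lra. }
  destruct (real_deriv_at_0 exp 1 e) as [d1 [Hd1 H1]]; auto.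
  { rewrite <- exp_0. apply derivable_pt_lim_exp. }
  destruct (real_deriv_at_0 cos 0 e) as [d2 [Hd2 H2]]; auto.
  { replace 0 with (- sin 0) at 2 by (rewrite sin_0; ring). apply derivable_pt_lim_cos. }
  destruct (real_deriv_at_0 sin 1 e) as [d3 [Hd3 H3]]; auto.
  { rewrite <- cos_0. apply derivable_pt_lim_sin. }
  (* Radius [e / 2] turns the second-order term [(exp x - 1) * y], at most [2 * r * r] in size, into
     at most [e * r]. *)
  exists (Rmin (e / 2) (Rmin d1 (Rmin d2 d3))). split.
  { repeat apply Rmin_glb_lt; lra. }
  intros w Hw.
  assert (Hd := Rmin_l (e / 2) (Rmin d1 (Rmin d2 d3))).
  assert (Hd' := Rmin_r (e / 2) (Rmin d1 (Rmin d2 d3))).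
  assert (Hd1' := Rmin_l d1 (Rmin d2 d3)).
  assert (Hd'' := Rmin_r d1 (Rmin d2 d3)).
  assert (Hd2' := Rmin_l d2 d3). assert (Hd3' := Rmin_r d2 d3).
  replace w with (z + (w - z))%C by ring.
  remember (w - z)%C as h eqn:Eh. clear Eh w.
  replace (z + h - z)%C with h by ring.
  rewrite Cexp_plus.
  replace (Cexp z * Cexp h - Cexp z - h * Cexp z)%C
    with (Cexp z * (Cexp h - 1 - h))%C by ring.
  rewrite Cmod_mult, Cmod_Cexp. fold M.
  assert (Hx := re_le_Cmod h). assert (Hy := Rabs_Im_le_Cmod h).
  specialize (H1 (Re h) ltac:(lra)). specialize (H2 (Im h) ltac:(lra)).
  specialize (H3 (Im h) ltac:(lra)).
  rewrite exp_0, Rmult_1_r in H1. rewrite cos_0, Rmult_0_r, Rminus_0_r in H2.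
  rewrite sin_0, Rmult_1_r, Rminus_0_r in H3.
  set (x := Re h) in *. set (y := Im h) in *.
  assert (Hr := Cmod_ge_0 h). set (r := Cmod h) in *.
  assert (Hex : Rabs (exp x - 1) <= 2 * r).
  { replace (exp x - 1) with ((exp x - 1 - x) + x) by ring.
    eapply Rle_trans; [apply Rabs_triang|]. nra. }
  assert (Hex3 : exp x <= 3).
  { assert (H := Rle_abs (exp x - 1)). lra. }
  assert (Hp := exp_pos x).
  assert (HR : Rabs (exp x * cos y - 1 - x) <= 4 * e * r).
  { replace (exp x * cos y - 1 - x)
      with (exp x * (cos y - 1) + (exp x - 1 - x)) by ring.
    eapply Rle_trans; [apply Rabs_triang|]. rewrite Rabs_mult, (Rabs_pos_eq (exp x)) by lra.
    assert (H := Rabs_pos (cos y - 1)). nra. }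
  assert (HI : Rabs (exp x * sin y - y) <= 5 * e * r).
  { replace (exp x * sin y - y)
      with (exp x * (sin y - y) + (exp x - 1) * y) by ring.
    eapply Rle_trans; [apply Rabs_triang|].
    rewrite !Rabs_mult, (Rabs_pos_eq (exp x)) by lra.
    assert (H := Rabs_pos (sin y - y)). assert (H' := Rabs_pos y).
    assert (H'' := Rabs_pos (exp x - 1)). 
    assert (exp x * Rabs (sin y - y) <= 3 * (e * r)) by nra.
    assert (Rabs (exp x - 1) * Rabs y <= e * r) by nra. nra. }
  assert (HC : Cmod (Cexp h - 1 - h) <= 9 * e * r).
  { eapply Rle_trans; [apply Cmod_le_sum|].
    replace (Re (Cexp h - 1 - h)) with (exp x * cos y - 1 - x)
      by (unfold x, y, Cexp, Cminus, Re, Im; simpl; ring).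
    replace (Im (Cexp h - 1 - h)) with (exp x * sin y - y)
      by (unfold x, y, Cexp, Cminus, Re, Im; simpl; ring).
    lra. }
  apply Rle_trans with (M * (9 * e * r)); [apply Rmult_le_compat_l; lra|]. nra.
Qed.

(** * The principal logarithm on the right half-plane *)

Lemma Cmod_pos_of_Re_pos (w : C) : 0 < Re w -> 0 < Cmod w.
Proof. intros Hw. assert (H := re_le_Cmod w). rewrite Rabs_pos_eq in H; lra. Qed.

(** For positive [x], [acos x = atan (sqrt (1 - x^2) / x)]; as [atan] is odd, the two cases of
    [Carg] merge into one visibly continuous formula. *)
Lemma Carg_atan (w : C) : 0 < Re w -> Carg w = atan (Im w / Re w).
Proof.
  intros Hw.
  assert (Hm := Cmod_pos_of_Re_pos w Hw).
  assert (H2 : Cmod w * Cmod w = Re w * Re w + Im w * Im w).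
  { unfold Cmod. rewrite sqrt_sqrt; unfold Re, Im; nra. }
  assert (Hq : sqrt (1 - (Re w / Cmod w)²) / (Re w / Cmod w) = Rabs (Im w) / Re w).
  { replace (1 - (Re w / Cmod w)²) with ((Im w / Cmod w)²).
    - rewrite sqrt_Rsqr_abs, Rabs_div, (Rabs_pos_eq (Cmod w)) by lra. field. lra.
    - unfold Rsqr. field_simplify; try lra. f_equal. lra. }
  unfold Carg. rewrite acos_atan by (apply Rdiv_lt_0_compat; lra). rewrite Hq.
  destruct (Rle_dec 0 (Im w)) as [Hi|Hi].
  - now rewrite Rabs_pos_eq.
  - rewrite Rabs_left, <- atan_opp by lra. f_equal. field. lra.
Qed.

Lemma Cexp_Clog (w : C) : 0 < Re w -> Cexp (Clog w) = w.
Proof.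
  intros Hw.
  assert (Hm := Cmod_pos_of_Re_pos w Hw).
  assert (H2 : Cmod w * Cmod w = Re w * Re w + Im w * Im w).
  { unfold Cmod. rewrite sqrt_sqrt; unfold Re, Im; nra. }
  assert (Hs : sqrt (1 + (Im w / Re w)²) = Cmod w / Re w).
  { apply sqrt_lem_1.
    - assert (H := Rle_0_sqr (Im w / Re w)). lra.
    - left. apply Rdiv_lt_0_compat; lra.
    - unfold Rsqr. transitivity ((Cmod w * Cmod w) / (Re w * Re w)).
      + field. lra.
      + rewrite H2. field. lra. }
  unfold Cexp, Clog. simpl (Re _). simpl (Im _).
  rewrite Carg_atan, exp_ln, cos_atan, sin_atan, Hs by lra.
  destruct w as [x y]; simpl in *.
  apply injective_projections; simpl; field; lra.
Qed.

Lemma Clog_RtoC (x : R) : 0 < x -> Clog (RtoC x) = RtoC (ln x).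
Proof.
  intros Hx. unfold Clog. rewrite Carg_atan by exact Hx.
  rewrite Cmod_R, Rabs_pos_eq by lra. simpl. unfold Rdiv.
  now rewrite Rmult_0_l, atan_0.
Qed.

(** Modulus and [atan] formula are handled separately; a radius of at most [Re w] keeps [w'] where
    that formula is valid. *)
Lemma Clog_continuous (w : C) : 0 < Re w ->
  forall eps, 0 < eps -> exists d, 0 < d /\ forall w', Cmod (w' - w) < d ->
    0 < Re w' /\ Cmod (Clog w' - Clog w) < eps.
Proof.
  intros Hw eps Heps.
  assert (Hm := Cmod_pos_of_Re_pos w Hw).
  assert (H1 : @continuous C_UniformSpace R_UniformSpace (fun z : C => ln (Cmod z)) w).
  { apply (continuous_comp Cmod ln).
    - apply (continuous_ext (fun z => @norm C_AbsRing C_NormedModule z)).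
      + intros z. symmetry. reflexivity.
      + apply (@filterlim_norm C_AbsRing C_NormedModule w).
    - apply (ex_derive_continuous (V := R_NormedModule)). eexists. now apply is_derive_ln. }
  assert (H2 : @continuous C_UniformSpace R_UniformSpace (fun z : C => atan (Im z / Re z)) w).
  { apply (continuous_comp (fun z : C => Im z / Re z) atan).
    - apply (@continuous_mult C_UniformSpace R_AbsRing Im (fun z : C => / Re z)).
      + destruct w as [x y]; apply (@continuous_snd R_UniformSpace R_UniformSpace x y).
      + apply (continuous_comp Re Rinv).
        * destruct w as [x y]; apply (@continuous_fst R_UniformSpace R_UniformSpace x y).
        * apply continuous_Rinv. lra.
    - apply (ex_derive_continuous (V := R_NormedModule)). eexists. apply is_derive_atan. }
  assert (Hh : 0 < eps / 2) by lra.
  destruct (proj1 (filterlim_locally _ _) H1 (mkposreal _ Hh)) as [d1 K1].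
  destruct (proj1 (filterlim_locally _ _) H2 (mkposreal _ Hh)) as [d2 K2].
  exists (Rmin (Re w) (Rmin d1 d2)). split.
  { repeat apply Rmin_glb_lt; [assumption | apply cond_pos | apply cond_pos]. }
  intros w' Hww.
  assert (Hr : 0 < Re w').
  { assert (H := re_le_Cmod (w' - w)).
    assert (H' := Rlt_le_trans _ _ _ Hww (Rmin_l _ _)).
    assert (H'' := Rle_abs (- Re (w' - w))). rewrite Rabs_Ropp in H''.
    replace (Re (w' - w)) with (Re w' - Re w) in * by (unfold Re, Im; simpl; ring). lra. }
  split; [assumption|].
  assert (H' := Rlt_le_trans _ _ _ Hww (Rmin_r _ _)).
  assert (B1 := C_NormedModule_mixin_compat1 w w' d1 (Rlt_le_trans _ _ _ H' (Rmin_l _ _))).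
  assert (B2 := C_NormedModule_mixin_compat1 w w' d2 (Rlt_le_trans _ _ _ H' (Rmin_r _ _))).
  specialize (K1 w' B1). specialize (K2 w' B2).
  change (Rabs (ln (Cmod w') - ln (Cmod w)) < eps / 2) in K1.
  change (Rabs (atan (Im w' / Re w') - atan (Im w / Re w)) < eps / 2) in K2.
  rewrite <- !Carg_atan in K2 by assumption.
  eapply Rle_lt_trans; [apply Cmod_le_sum|].
  replace (Re (Clog w' - Clog w)) with (ln (Cmod w') - ln (Cmod w)) by (unfold Re, Im; simpl; ring).
  replace (Im (Clog w' - Clog w)) with (Carg w' - Carg w) by (unfold Re, Im; simpl; ring).
  lra.
Qed.

(** Inverse function rule: by continuity of [Clog], the first-order expansion of [Cexp] at [Clog w]
    can be solved for the increment of [Clog]. *)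
Lemma Cderiv_Clog (w : C) : 0 < Re w -> Cderiv Clog w (/ w)%C.
Proof.
  intros Hw. apply Cderiv_iff. intros eps Heps.
  assert (Hm := Cmod_pos_of_Re_pos w Hw).
  assert (Hw0 : w <> RtoC 0) by now apply Cmod_gt_0.
  set (m := Cmod w) in *.
  (* The first bound on [e] gives [Cmod v * m <= 2 * Cmod h]; the second then makes [e * Cmod v] at
     most [eps * m * Cmod h]. *)
  set (e := Rmin (m / 2) (eps * m * m / 2)).
  assert (He : 0 < e).
  { apply Rmin_glb_lt; [lra|]. assert (0 < eps * m) by nra. nra. }
  destruct (proj1 (Cderiv_iff Cexp (Clog w) _) (Cderiv_Cexp (Clog w)) e He) as [d [Hd K]].
  destruct (Clog_continuous w Hw d Hd) as [d' [Hd' K']].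
  exists d'. split; [assumption|]. intros w' Hw'.
  destruct (K' w' Hw') as [Hr Hc]. specialize (K _ Hc).
  rewrite !Cexp_Clog in K by assumption.
  set (v := (Clog w' - Clog w)%C) in *. set (h := (w' - w)%C) in *.
  replace (v - h * / w)%C with (- ((h - v * w) * / w))%C by (field; assumption).
  rewrite Cmod_opp, Cmod_mult, Cmod_inv by assumption. fold m.
  assert (Hv : Cmod v * m <= Cmod h + e * Cmod v).
  { unfold m. rewrite <- Cmod_mult.
    replace (v * w)%C with (h + - (h - v * w))%C by ring.
    eapply Rle_trans; [apply Cmod_triangle|]. rewrite Cmod_opp. lra. }
  assert (E1 : e <= m / 2) by apply Rmin_l.
  assert (E2 : e <= eps * m * m / 2) by apply Rmin_r.
  assert (Pv := Cmod_ge_0 v). assert (Ph := Cmod_ge_0 h).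
  apply Rmult_le_reg_r with m; [lra|].
  rewrite Rmult_assoc, Rinv_l, Rmult_1_r by lra.
  apply (Rle_trans _ _ _ K).
  assert (Hv2 : Cmod v * m <= 2 * Cmod h) by nra.
  apply Rle_trans with ((eps * m * m / 2) * Cmod v); [nra|].
  replace (eps * m * m / 2 * Cmod v) with (eps * m / 2 * (Cmod v * m)) by field.
  assert (0 < eps * m) by nra. nra.
Qed.

(** * Comparison of a complex increment with a real majorant *)

Lemma Cderiv_real_axis (f : C -> C) (t : R) (l : C) :
  Cderiv f (RtoC t) l -> is_derive (fun x : R => Re (f (RtoC x))) t (Re l).
Proof.
  intros H. apply is_derive_Reals. intros eps Heps.
  destruct (proj1 (Cderiv_iff _ _ _) H (eps / 2) ltac:(lra)) as [d [Hd K]].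
  exists (mkposreal d Hd). simpl. intros h Hh Hhd.
  specialize (K (RtoC (t + h))).
  replace (RtoC (t + h) - RtoC t)%C with (RtoC h) in K by (rewrite RtoC_plus; ring).
  rewrite Cmod_R in K. specialize (K Hhd).
  assert (K' := Rle_trans _ _ _ (re_le_Cmod _) K).
  assert (Hp : 0 < Rabs h) by now apply Rabs_pos_lt.
  replace (Re (f (RtoC (t + h)) - f (RtoC t) - RtoC h * l))
    with (((Re (f (RtoC (t + h))) - Re (f (RtoC t))) / h - Re l) * h) in K'.
  - rewrite Rabs_mult in K'. apply Rmult_le_reg_r in K'; lra.
  - unfold Cminus. rewrite !re_plus, !re_opp, re_scal_l. now field.
Qed.

(* A unimodular factor turns [f z - f 0] into the real number [Cmod (f z - f 0)], which reduces
   the comparison to the monotonicity of a real function along the ray through [z]. *)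
Lemma Cmod_le_majorant (f f' g g' : C -> C) (z : C) :
  (forall w, Cmod w <= Cmod z -> Cderiv f w (f' w)) ->
  (forall w, Cmod w <= Cmod z -> Cderiv g w (g' w)) ->
  (forall w, Cmod w <= Cmod z -> Cmod (f' w) <= Re (g' (RtoC (Cmod w)))) ->
  Cmod (f z - f (RtoC 0)) <= Re (g (RtoC (Cmod z))) - Re (g (RtoC 0)).
Proof.
  intros Hf Hg Hfg.
  set (D := (f z - f (RtoC 0))%C).
  assert (Hc : exists c : C, Cmod c <= 1 /\ (c * D)%C = RtoC (Cmod D)).
  { destruct (Ceq_dec D (RtoC 0)) as [E|E].
    - exists (RtoC 1). rewrite E, Cmod_0, Cmod_1. split; [lra | ring].
    - assert (HD := proj1 (Cmod_gt_0 D) E).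
      exists (RtoC (Cmod D) / D)%C. split.
      + rewrite Cmod_div, Cmod_R, Rabs_pos_eq by (assumption || lra).
        unfold Rdiv. rewrite Rinv_r; lra.
      + field. assumption. }
  destruct Hc as [c [Hc1 Hc2]].
  set (G := fun w : C => (g (RtoC (Cmod z) * w) - c * f (z * w))%C).
  set (G' := fun w : C => (RtoC (Cmod z) * g' (RtoC (Cmod z) * w) - c * (z * f' (z * w)))%C).
  assert (Hz := Cmod_ge_0 z).
  assert (HG : forall t, 0 <= t <= 1 ->
            is_derive (fun x : R => Re (G (RtoC x))) t (Re (G' (RtoC t)))).
  { intros t Ht. apply Cderiv_real_axis. unfold G, G'.
    assert (Hlin : forall a : C, Cderiv (fun w => a * w)%C (RtoC t) a).
    { intros a. eapply Cderiv_eq; [apply Cderiv_scal, Cderiv_id | ring]. }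
    apply Cderiv_minus.
    - apply (Cderiv_comp g); [apply Hg | apply Hlin].
      rewrite Cmod_mult, !Cmod_R, !Rabs_pos_eq by lra. nra.
    - apply Cderiv_scal. apply (Cderiv_comp f); [apply Hf | apply Hlin].
      rewrite Cmod_mult, !Cmod_R, !Rabs_pos_eq by lra. nra. }
  assert (HG' : forall t, 0 <= t <= 1 -> 0 <= Re (G' (RtoC t))).
  { intros t Ht. unfold G'.
    assert (Hmt : Cmod (z * RtoC t) = Cmod z * t)
      by (rewrite Cmod_mult, Cmod_R, Rabs_pos_eq; lra).
    assert (H := Hfg (z * RtoC t)%C ltac:(rewrite Hmt; nra)).
    rewrite Hmt, RtoC_mult in H.
    unfold Cminus. rewrite re_plus, re_opp, re_scal_l.
    assert (H' := Rle_trans _ _ _ (Rle_abs _)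
                    (re_le_Cmod (c * (z * f' (z * RtoC t))%C))).
    rewrite !Cmod_mult in H'.
    assert (P := Cmod_ge_0 (f' (z * RtoC t)%C)). assert (Pc := Cmod_ge_0 c).
    assert (Cmod c * (Cmod z * Cmod (f' (z * RtoC t)%C)) <= Cmod z * Cmod (f' (z * RtoC t)%C)).
    { rewrite <- (Rmult_1_l (Cmod z * Cmod (f' (z * RtoC t)%C))) at 2.
      apply Rmult_le_compat_r; [nra | assumption]. }
    nra. }
  destruct (MVT_gen (fun x : R => Re (G (RtoC x))) 0 1 (fun t => Re (G' (RtoC t))))
    as [t [Ht E]].
  { rewrite Rmin_left, Rmax_right by lra. intros x Hx. apply HG. lra. }
  { rewrite Rmin_left, Rmax_right by lra. intros x Hx.
    apply continuity_pt_filterlim.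
    apply (ex_derive_continuous (V := R_NormedModule)). eexists. apply HG. lra. }
  rewrite Rmin_left, Rmax_right in Ht by lra.
  specialize (HG' t Ht).
  replace (Re (G (RtoC 1)) - Re (G (RtoC 0)))
    with (Re (g (RtoC (Cmod z))) - Re (g (RtoC 0)) - Re (c * D)%C) in E.
  - rewrite Hc2, re_RtoC in E. lra.
  - unfold G, D. rewrite !Cmult_0_r, !Cmult_1_r.
    replace (c * (f z - f (RtoC 0)))%C with (c * f z - c * f (RtoC 0))%C by ring.
    unfold Cminus. rewrite !re_plus, !re_opp. ring.
Qed.

Lemma exp_le (x y : R) : x <= y -> exp x <= exp y.
Proof.
  intros [H | ->]; [left; now apply exp_increasing | apply Rle_refl].
Qed.

(** * Coefficients and partial sums of [(1 - u)^(- lam)] *)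

(** The rising factorial of [lam] of length [k] divided by [k!], given by its ratio recurrence. *)
Fixpoint binom_coef (lam : R) (k : nat) : R :=
  match k with
  | O => 1
  | S k => binom_coef lam k * ((lam + INR k) / (INR k + 1))
  end.

Lemma binom_coef_pos (lam : R) (k : nat) : 0 < lam -> 0 < binom_coef lam k.
Proof.
  intros Hl. induction k as [|k IH]; simpl; [lra|].
  assert (H := pos_INR k). apply Rmult_lt_0_compat; [assumption|].
  apply Rdiv_lt_0_compat; lra.
Qed.

(** The ratio [(lam + k) / (k + 1)] is at most [1] exactly because [lam <= 1]. *)
Lemma binom_coef_decr (lam : R) (k : nat) :
  0 < lam <= 1 -> binom_coef lam (S k) <= binom_coef lam k.
Proof.
  intros Hl. simpl. assert (H := pos_INR k).
  assert (Hp := binom_coef_pos lam k (proj1 Hl)).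
  rewrite <- Rmult_1_r. apply Rmult_le_compat_l; [lra|].
  apply Rle_div_l; lra.
Qed.

Lemma binom_coef_le_1 (lam : R) (k : nat) : 0 < lam <= 1 -> binom_coef lam k <= 1.
Proof.
  intros Hl. induction k as [|k IH]; [simpl; lra|].
  eapply Rle_trans; [now apply binom_coef_decr | exact IH].
Qed.

Definition binom_sum (lam : R) (n : nat) (u : C) : C :=
  partial_sum (fun k => RtoC (binom_coef lam k)) n u.

Lemma binom_sum_0 (lam : R) (u : C) : binom_sum lam 0 u = RtoC 1.
Proof. unfold binom_sum, partial_sum. rewrite sum_O. simpl. ring. Qed.

Lemma binom_sum_S (lam : R) (n : nat) (u : C) :
  binom_sum lam (S n) u = (binom_sum lam n u + RtoC (binom_coef lam (S n)) * u ^ S n)%C.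
Proof. unfold binom_sum, partial_sum. rewrite sum_Sn. reflexivity. Qed.

Lemma binom_sum_at_0 (lam : R) (n : nat) : binom_sum lam n (RtoC 0) = RtoC 1.
Proof.
  induction n as [|n IH]; [apply binom_sum_0|].
  rewrite binom_sum_S, IH, Cpow_S. ring.
Qed.

Definition binom_sum_R (lam : R) (n : nat) (x : R) : R :=
  sum_n (fun k => binom_coef lam k * x ^ k) n.

Lemma binom_sum_RtoC (lam : R) (n : nat) (x : R) :
  binom_sum lam n (RtoC x) = RtoC (binom_sum_R lam n x).
Proof.
  unfold binom_sum_R. induction n as [|n IH].
  - rewrite binom_sum_0, sum_O. simpl. now rewrite Rmult_1_r.
  - rewrite binom_sum_S, IH, sum_Sn, <- RtoC_pow, <- RtoC_mult, <- RtoC_plus. reflexivity.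
Qed.

Lemma binom_sum_R_ge_1 (lam : R) (n : nat) (x : R) :
  0 < lam -> 0 <= x -> 1 <= binom_sum_R lam n x.
Proof.
  intros Hl Hx. unfold binom_sum_R. induction n as [|n IH].
  - rewrite sum_O. simpl. lra.
  - rewrite sum_Sn.
    assert (H : 0 <= binom_coef lam (S n) * x ^ S n).
    { apply Rmult_le_pos; [left; now apply binom_coef_pos | now apply pow_le]. }
    unfold plus; simpl plus. simpl in *. lra.
Qed.

Lemma Cmod_binom_sum_le (lam : R) (n : nat) (u : C) :
  0 < lam -> Cmod (binom_sum lam n u) <= binom_sum_R lam n (Cmod u).
Proof.
  intros Hl. unfold binom_sum_R. induction n as [|n IH].
  - rewrite binom_sum_0, sum_O, Cmod_1. simpl. lra.
  - rewrite binom_sum_S, sum_Sn. eapply Rle_trans; [apply Cmod_triangle|].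
    rewrite Cmod_mult, Cmod_pow, Cmod_R, Rabs_pos_eq by (left; now apply binom_coef_pos).
    apply Rplus_le_compat_r. exact IH.
Qed.

(** * The differential identity of the partial sums *)

Fixpoint binom_sum' (lam : R) (n : nat) (u : C) : C :=
  match n with
  | O => RtoC 0
  | S n => (binom_sum' lam n u + RtoC (binom_coef lam (S n) * INR (S n)) * u ^ n)%C
  end.

Lemma Cderiv_pow (n : nat) (u : C) :
  Cderiv (fun w => w ^ S n)%C u (RtoC (INR (S n)) * u ^ n)%C.
Proof.
  induction n as [|n IH].
  - eapply Cderiv_eq.
    + eapply (is_derive_ext (K := C_AbsRing) (V := AbsRing_NormedModule C_AbsRing));
        [|apply Cderiv_id].
      intros w. simpl. symmetry. apply Cmult_1_r.
    + simpl. ring.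
  - eapply Cderiv_eq.
    + eapply (is_derive_ext (K := C_AbsRing) (V := AbsRing_NormedModule C_AbsRing));
        [|apply (Cderiv_mult _ _ _ _ _ (Cderiv_id u) IH)].
      intros w. reflexivity.
    + rewrite (S_INR (S n)), RtoC_plus, Cpow_S. ring.
Qed.

Lemma Cderiv_binom_sum (lam : R) (n : nat) (u : C) :
  Cderiv (binom_sum lam n) u (binom_sum' lam n u).
Proof.
  induction n as [|n IH].
  - eapply (is_derive_ext (K := C_AbsRing) (V := AbsRing_NormedModule C_AbsRing));
      [|apply Cderiv_const].
    intros w. symmetry. apply binom_sum_0.
  - eapply (is_derive_ext (K := C_AbsRing) (V := AbsRing_NormedModule C_AbsRing)).
    { intros w. symmetry. apply binom_sum_S. }
    eapply Cderiv_eq.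
    + apply Cderiv_plus; [apply IH|]. apply Cderiv_scal, Cderiv_pow.
    + cbn [binom_sum']. rewrite RtoC_mult. ring.
Qed.

(* [(1 - u)^(- lam)] solves [(1 - u) F' = lam F]; truncation leaves a single term. *)
Lemma binom_sum_ode (lam : R) (n : nat) (u : C) :
  ((1 - u) * binom_sum' lam n u =
   RtoC lam * binom_sum lam n u - RtoC ((lam + INR n) * binom_coef lam n) * u ^ n)%C.
Proof.
  induction n as [|n IH].
  - rewrite binom_sum_0. simpl. rewrite Rplus_0_r, Rmult_1_r. ring.
  - cbn [binom_sum']. rewrite Cmult_plus_distr_l, IH, binom_sum_S, Cpow_S.
    set (s := binom_sum lam n u). set (c1 := binom_coef lam (S n)).
    (* By this recurrence the leftover term of stage [n] cancels the [u ^ n] part contributed by the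
       new monomial. *)
    assert (E : (lam + INR n) * binom_coef lam n = INR (S n) * c1).
    { unfold c1. cbn [binom_coef]. rewrite S_INR. assert (H := pos_INR n). field. lra. }
    rewrite E, !RtoC_mult, !RtoC_plus. ring.
Qed.

(** * The Enestrom-Kakeya estimate *)

(** By summation by parts the expression is minus the sum of [(c_(k-1) - c_k) u^k] for [k] from [1]
    to [n]. The differences are nonnegative and telescope to [1 - c_n], and each power has modulus
    at most [Cmod u]. *)
Lemma Cmod_binom_remainder (lam : R) (n : nat) (u : C) :
  0 < lam <= 1 -> Cmod u <= 1 ->
  Cmod ((1 - u) * binom_sum lam n u - 1 + RtoC (binom_coef lam n) * u ^ S n)
    <= (1 - binom_coef lam n) * Cmod u.
Proof.
  intros Hl Hu. assert (Hu0 := Cmod_ge_0 u).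
  induction n as [|n IH].
  - rewrite binom_sum_0. simpl.
    replace ((1 - u) * 1 - 1 + 1 * (u * 1))%C with (RtoC 0) by ring.
    rewrite Cmod_0. lra.
  - rewrite binom_sum_S.
    set (c0 := binom_coef lam n) in *. set (c1 := binom_coef lam (S n)).
    replace (_ + _)%C with
      (((1 - u) * binom_sum lam n u - 1 + RtoC c0 * u ^ S n) + - (RtoC (c0 - c1) * u ^ S n))%C
      by (rewrite RtoC_minus, (Cpow_S _ (S n)); ring).
    eapply Rle_trans; [apply Cmod_triangle|].
    assert (Hd : c1 <= c0) by now apply binom_coef_decr.
    rewrite Cmod_opp, Cmod_mult, Cmod_R, Cmod_pow, Rabs_pos_eq by lra.
    assert (Hp : Cmod u ^ S n <= Cmod u).
    { simpl. rewrite <- Rmult_1_r. apply Rmult_le_compat_l; [assumption|].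
      rewrite <- (pow1 n). now apply pow_incr. }
    nra.
Qed.

(* Enestrom-Kakeya: the coefficients of [binom_sum] are positive and decreasing. *)
Lemma Cmod_binom_sum_near_1 (lam : R) (n : nat) (u : C) :
  0 < lam <= 1 -> Cmod u <= 1 -> Cmod ((1 - u) * binom_sum lam n u - 1) <= Cmod u.
Proof.
  intros Hl Hu. assert (Hu0 := Cmod_ge_0 u).
  assert (H := Cmod_binom_remainder lam n u Hl Hu).
  assert (Hc := binom_coef_pos lam n (proj1 Hl)).
  replace ((1 - u) * binom_sum lam n u - 1)%C with
    (((1 - u) * binom_sum lam n u - 1 + RtoC (binom_coef lam n) * u ^ S n)
     + - (RtoC (binom_coef lam n) * u ^ S n))%C by ring.
  eapply Rle_trans; [apply Cmod_triangle|].
  rewrite Cmod_opp, Cmod_mult, Cmod_R, Cmod_pow, Rabs_pos_eq by lra.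
  assert (Hp : Cmod u ^ S n <= Cmod u).
  { simpl. rewrite <- Rmult_1_r. apply Rmult_le_compat_l; [assumption|].
    rewrite <- (pow1 n). now apply pow_incr. }
  nra.
Qed.

Lemma Re_pos_near_1 (w : C) : Cmod (w - 1) < 1 -> 0 < Re w.
Proof.
  intros H. assert (H' := re_le_Cmod (w - 1)).
  assert (H'' := Rle_abs (- Re (w - 1))). rewrite Rabs_Ropp in H''.
  replace (Re (w - 1)) with (Re w - 1) in * by (unfold Re, Im; simpl; ring). lra.
Qed.

Lemma Re_pos_nz (w : C) : 0 < Re w -> w <> RtoC 0.
Proof. intros H E. rewrite E in H. simpl in H. lra. Qed.

Lemma Re_one_minus_pos (u : C) : Cmod u < 1 -> 0 < Re (1 - u).
Proof.
  intros H. apply Re_pos_near_1. replace (1 - u - 1)%C with (- u)%C by ring.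
  now rewrite Cmod_opp.
Qed.

Lemma Re_binom_pos (lam : R) (n : nat) (u : C) :
  0 < lam <= 1 -> Cmod u < 1 -> 0 < Re ((1 - u) * binom_sum lam n u).
Proof.
  intros Hl H. apply Re_pos_near_1. eapply Rle_lt_trans; [|exact H].
  apply Cmod_binom_sum_near_1; lra || assumption.
Qed.

Lemma binom_sum_nz (lam : R) (n : nat) (u : C) :
  0 < lam <= 1 -> Cmod u < 1 -> binom_sum lam n u <> RtoC 0.
Proof.
  intros Hl H E. apply (Re_pos_nz _ (Re_binom_pos lam n u Hl H)). rewrite E. ring.
Qed.

(** * An analytic logarithm of the partial sums *)

Lemma Cderiv_Clog_one_minus (u : C) :
  Cmod u < 1 -> Cderiv (fun w => Clog (1 - w)) u (- / (1 - u))%C.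
Proof.
  intros Hu. eapply Cderiv_eq.
  - apply (Cderiv_comp Clog (fun w => 1 - w)%C).
    + apply Cderiv_Clog, Re_one_minus_pos, Hu.
    + apply Cderiv_minus; [apply Cderiv_const | apply Cderiv_id].
  - ring.
Qed.

(* Both logarithms are evaluated in the right half-plane, so this is an analytic branch of the
   logarithm of [binom_sum], which itself may leave the half-plane. *)
Definition log_binom_sum (lam : R) (n : nat) (u : C) : C :=
  (Clog ((1 - u) * binom_sum lam n u) - Clog (1 - u))%C.

Lemma Cexp_minus (z w : C) : Cexp (z - w) = (Cexp z / Cexp w)%C.
Proof. unfold Cminus, Cdiv. now rewrite Cexp_plus, Cinv_Cexp. Qed.

Lemma Cexp_log_binom_sum (lam : R) (n : nat) (u : C) :
  0 < lam <= 1 -> Cmod u < 1 -> Cexp (log_binom_sum lam n u) = binom_sum lam n u.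
Proof.
  intros Hl Hu. unfold log_binom_sum.
  rewrite Cexp_minus, !Cexp_Clog by auto using Re_binom_pos, Re_one_minus_pos.
  field. now apply Re_pos_nz, Re_one_minus_pos.
Qed.

Lemma Re_log_binom_sum (lam : R) (n : nat) (u : C) :
  0 < lam <= 1 -> Cmod u < 1 ->
  Re (log_binom_sum lam n u) = ln (Cmod (binom_sum lam n u)).
Proof.
  intros Hl Hu. now rewrite <- Cexp_log_binom_sum, Cmod_Cexp, ln_exp.
Qed.

Lemma log_binom_sum_RtoC (lam : R) (n : nat) (x : R) :
  0 < lam -> 0 <= x < 1 ->
  log_binom_sum lam n (RtoC x) = RtoC (ln (binom_sum_R lam n x)).
Proof.
  intros Hl Hx. unfold log_binom_sum.
  assert (H := binom_sum_R_ge_1 lam n x Hl (proj1 Hx)).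
  rewrite binom_sum_RtoC, <- RtoC_minus, <- RtoC_mult, !Clog_RtoC, <- RtoC_minus, ln_mult
    by (lra || apply Rmult_lt_0_compat; lra).
  f_equal. ring.
Qed.

Lemma Cderiv_log_binom_sum (lam : R) (n : nat) (u : C) :
  0 < lam <= 1 -> Cmod u < 1 ->
  Cderiv (log_binom_sum lam n) u (binom_sum' lam n u / binom_sum lam n u)%C.
Proof.
  intros Hl Hu. eapply Cderiv_eq.
  - apply Cderiv_minus; [|now apply Cderiv_Clog_one_minus].
    apply (Cderiv_comp Clog (fun w => (1 - w) * binom_sum lam n w)%C).
    + now apply Cderiv_Clog, Re_binom_pos.
    + apply (Cderiv_mult (fun w => 1 - w)%C).
      * apply Cderiv_minus; [apply Cderiv_const | apply Cderiv_id].
      * apply Cderiv_binom_sum.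
  - cbv beta. field. split.
    + now apply binom_sum_nz.
    + now apply Re_pos_nz, Re_one_minus_pos.
Qed.

(** * The Schwarz function *)

(** A logarithm of [1 - Omega]; the root of [s] is taken through the branch [log_binom_sum], not
    through the principal power. *)
Definition log_root (lam : R) (n : nat) (u : C) : C :=
  (Clog (1 - u) + RtoC (/ lam) * log_binom_sum lam n u)%C.

Definition schwarz_fun (lam : R) (n : nat) (u : C) : C := (1 - Cexp (log_root lam n u))%C.

(** The exponential is the branch of [s^(1/lam - 1)]. Neither [s'] nor [1 / (1 - u)] is left, which
    is what makes a termwise majorant possible. *)
Definition schwarz_fun' (lam : R) (n : nat) (u : C) : C :=
  (RtoC (/ lam * ((lam + INR n) * binom_coef lam n)) * u ^ n
   * Cexp (RtoC (/ lam - 1) * log_binom_sum lam n u))%C.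

Lemma Cderiv_log_root (lam : R) (n : nat) (u : C) :
  0 < lam <= 1 -> Cmod u < 1 ->
  Cderiv (log_root lam n) u
    (- / (1 - u) + RtoC (/ lam) * (binom_sum' lam n u / binom_sum lam n u))%C.
Proof.
  intros Hl Hu. apply Cderiv_plus; [now apply Cderiv_Clog_one_minus|].
  now apply Cderiv_scal, Cderiv_log_binom_sum.
Qed.

Lemma Cderiv_schwarz_fun (lam : R) (n : nat) (u : C) :
  0 < lam <= 1 -> Cmod u < 1 -> Cderiv (schwarz_fun lam n) u (schwarz_fun' lam n u).
Proof.
  intros Hl Hu.
  assert (H1 := Re_pos_nz _ (Re_one_minus_pos u Hu)).
  assert (Hs := binom_sum_nz lam n u Hl Hu).
  eapply Cderiv_eq.
  - apply Cderiv_minus; [apply Cderiv_const|].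
    apply (Cderiv_comp Cexp); [apply Cderiv_Cexp | now apply Cderiv_log_root].
  - unfold schwarz_fun'.
    (* Splitting one factor [s] off [s^(1/lam)] cancels the denominator of the logarithmic
       derivative [s' / s]. *)
    assert (E : Cexp (log_root lam n u) =
      ((1 - u) * (Cexp (RtoC (/ lam - 1) * log_binom_sum lam n u) * binom_sum lam n u))%C).
    { unfold log_root. rewrite Cexp_plus, Cexp_Clog by now apply Re_one_minus_pos.
      f_equal. rewrite <- (Cexp_log_binom_sum lam n u Hl Hu). rewrite <- Cexp_plus.
      f_equal. rewrite RtoC_minus. ring. }
    rewrite E. set (e := Cexp (RtoC (/ lam - 1) * _)).
    (* Isolates [(1 - u) * s'], so that [binom_sum_ode] applies and the terms in [s] cancel. *)
    transitivity (e * (binom_sum lam n u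
      - RtoC (/ lam) * ((1 - u) * binom_sum' lam n u)))%C; [field; auto|].
    rewrite binom_sum_ode.
    assert (Er : (RtoC (/ lam) * RtoC lam)%C = RtoC 1)
      by (rewrite <- RtoC_mult; f_equal; field; lra).
    transitivity (e * (binom_sum lam n u - (RtoC (/ lam) * RtoC lam) * binom_sum lam n u
      + RtoC (/ lam) * (RtoC ((lam + INR n) * binom_coef lam n) * u ^ n)))%C; [ring|].
    rewrite Er, (RtoC_mult (/ lam)). ring.
Qed.

Lemma Cmod_schwarz_fun'_le (lam : R) (n : nat) (u : C) :
  0 < lam <= 1 -> Cmod u < 1 ->
  Cmod (schwarz_fun' lam n u) <= Re (schwarz_fun' lam n (RtoC (Cmod u))).
Proof.
  intros Hl Hu. assert (Hu0 := Cmod_ge_0 u).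
  assert (Hc := binom_coef_pos lam n (proj1 Hl)). assert (Hn := pos_INR n).
  assert (Hi : 1 <= / lam) by (rewrite <- Rinv_1; apply Rinv_le_contravar; lra).
  assert (HK : 0 <= / lam * ((lam + INR n) * binom_coef lam n)).
  { apply Rmult_le_pos; [lra|]. apply Rmult_le_pos; lra. }
  unfold schwarz_fun'.
  rewrite log_binom_sum_RtoC by lra.
  rewrite <- RtoC_pow, <- !RtoC_mult, Cexp_RtoC, <- RtoC_mult, re_RtoC.
  rewrite !Cmod_mult, Cmod_R, Cmod_pow, Cmod_Cexp, Rabs_pos_eq by assumption.
  apply Rmult_le_compat_l; [apply Rmult_le_pos; [assumption | now apply pow_le]|].
  (* The modulus of the exponential sees only the real part [ln (Cmod s)], and its factor
     [/ lam - 1] is nonnegative. *)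
  rewrite re_scal_l, Re_log_binom_sum by assumption.
  apply exp_le. apply Rmult_le_compat_l; [lra|].
  apply ln_le; [|now apply Cmod_binom_sum_le].
  apply Cmod_gt_0. now apply binom_sum_nz.
Qed.

Lemma log_root_0 (lam : R) (n : nat) : log_root lam n (RtoC 0) = RtoC 0.
Proof.
  unfold log_root, log_binom_sum. rewrite binom_sum_at_0.
  replace ((1 - 0) * 1)%C with (RtoC 1) by ring. replace (1 - 0)%C with (RtoC 1) by ring.
  rewrite Clog_RtoC, ln_1 by lra. ring.
Qed.

Lemma schwarz_fun_0 (lam : R) (n : nat) : schwarz_fun lam n (RtoC 0) = RtoC 0.
Proof. unfold schwarz_fun. rewrite log_root_0, Cexp_0. ring. Qed.

Lemma Cmod_schwarz_fun_le (lam : R) (n : nat) (u : C) :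
  0 < lam <= 1 -> Cmod u < 1 -> Cmod (schwarz_fun lam n u) <= Cmod u.
Proof.
  intros Hl Hu. assert (Hu0 := Cmod_ge_0 u).
  assert (H := Cmod_le_majorant (schwarz_fun lam n) (schwarz_fun' lam n)
                 (schwarz_fun lam n) (schwarz_fun' lam n) u).
  rewrite schwarz_fun_0 in H.
  replace (schwarz_fun lam n u - 0)%C with (schwarz_fun lam n u) in H by ring.
  eapply Rle_trans; [apply H|].
  - intros w Hw. apply Cderiv_schwarz_fun; lra.
  - intros w Hw. apply Cderiv_schwarz_fun; lra.
  - intros w Hw. apply Cmod_schwarz_fun'_le; lra.
  (* The function is its own majorant. With [r = Cmod u] there remains
     [1 - (1 - r) s(r)^(1/lam) <= r], true since [s(r) >= 1]. *)
  - unfold schwarz_fun, log_root. rewrite log_binom_sum_RtoC by lra.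
    rewrite Cexp_plus, Cexp_Clog, <- RtoC_mult, Cexp_RtoC, <- RtoC_minus, <- RtoC_mult,
      <- RtoC_minus, !re_RtoC.
    2: { rewrite <- RtoC_minus, re_RtoC. lra. }
    assert (Hs := binom_sum_R_ge_1 lam n (Cmod u) (proj1 Hl) Hu0).
    assert (Hln : 0 <= ln (binom_sum_R lam n (Cmod u))).
    { rewrite <- ln_1. apply ln_le; lra. }
    assert (Hi : 0 < / lam) by (apply Rinv_0_lt_compat; lra).
    assert (He : 1 <= exp (/ lam * ln (binom_sum_R lam n (Cmod u)))).
    { rewrite <- exp_0. apply exp_le. nra. }
    nra.
Qed.

(* Both sides have the same derivative and agree at [0]. *)
Lemma Clog_one_minus_schwarz_fun (lam : R) (n : nat) (u : C) :
  0 < lam <= 1 -> Cmod u < 1 -> Clog (1 - schwarz_fun lam n u) = log_root lam n u.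
Proof.
  intros Hl Hu.
  set (f := fun w => (Clog (Cexp (log_root lam n w)) - log_root lam n w)%C).
  (* With the zero majorant the comparison says that a vanishing derivative forces constancy. *)
  assert (H : Cmod (f u - f (RtoC 0)) <= Re (RtoC 0) - Re (RtoC 0)).
  { apply (Cmod_le_majorant f (fun _ => RtoC 0) (fun _ => RtoC 0) (fun _ => RtoC 0)).
    - intros w Hw. assert (Hw1 : Cmod w < 1) by lra.
      eapply Cderiv_eq.
      + apply Cderiv_minus; [|now apply Cderiv_log_root].
        apply (Cderiv_comp Clog).
        (* The bound on [schwarz_fun] is what places this point in the right half-plane. *)
        * apply Cderiv_Clog.
          replace (Cexp (log_root lam n w)) with (1 - schwarz_fun lam n w)%C
            by (unfold schwarz_fun; ring).
          apply Re_one_minus_pos. eapply Rle_lt_trans; [|exact Hw1].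
          now apply Cmod_schwarz_fun_le.
        * apply (Cderiv_comp Cexp); [apply Cderiv_Cexp | now apply Cderiv_log_root].
      + assert (Hz := Cexp_nz (log_root lam n w)).
        set (e := Cexp (log_root lam n w)) in *.
        set (d := (_ + _)%C).
        transitivity (d * (e * / e) - d)%C; [ring|]. rewrite Cinv_r by assumption. ring.
    - intros w _. apply Cderiv_const.
    - intros w _. rewrite Cmod_0. simpl. lra. }
  rewrite Rminus_diag in H.
  assert (H0 : Cmod (f u - f (RtoC 0)) = 0) by (apply Rle_antisym; [assumption | apply Cmod_ge_0]).
  apply Cmod_eq_0 in H0.
  assert (E0 : f (RtoC 0) = RtoC 0).
  { unfold f. rewrite log_root_0, Cexp_0, Clog_RtoC, ln_1 by lra. ring. }
  rewrite E0 in H0. unfold f in H0.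
  unfold schwarz_fun. replace (1 - (1 - Cexp (log_root lam n u)))%C
    with (Cexp (log_root lam n u)) by ring.
  apply Ceq_minus. rewrite <- H0. ring.
Qed.

(** The subordination in the variable [u]: multiplying [log_root] by [lam] undoes the root. *)
Lemma Cpower_one_minus_schwarz_fun (lam : R) (n : nat) (u : C) :
  0 < lam <= 1 -> Cmod u < 1 ->
  Cpower (1 - schwarz_fun lam n u) lam = (binom_sum lam n u * Cpower (1 - u) lam)%C.
Proof.
  intros Hl Hu. unfold Cpower. rewrite Clog_one_minus_schwarz_fun by assumption.
  rewrite <- (Cexp_log_binom_sum lam n u Hl Hu), <- Cexp_plus. f_equal.
  unfold log_root. rewrite Cmult_plus_distr_l, Cmult_assoc, <- RtoC_mult, Rinv_r by lra.
  ring.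
Qed.

(** * Convergence of the binomial series *)

Lemma Cderiv_Cpower_one_minus (lam : R) (u : C) :
  Cmod u < 1 ->
  Cderiv (fun w => Cpower (1 - w) lam) u (- (RtoC lam * / (1 - u)) * Cpower (1 - u) lam)%C.
Proof.
  intros Hu. eapply Cderiv_eq.
  - apply (Cderiv_comp Cexp); [apply Cderiv_Cexp|].
    apply Cderiv_scal. now apply Cderiv_Clog_one_minus.
  - unfold Cpower. ring.
Qed.

(** The derivative is [- (lam + n) c_n w^n (1 - w)^lam / (1 - w)]. For [Cmod w <= Cmod u], the
    bounds [c_n <= 1], [lam <= 1] and [Cmod (1 - w) <= 2] make it at most the constant [K], so a
    linear majorant suffices. *)
Lemma Cmod_binom_sum_Cpower_minus_1 (lam : R) (n : nat) (u : C) :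
  0 < lam <= 1 -> Cmod u < 1 ->
  Cmod (binom_sum lam n u * Cpower (1 - u) lam - 1) <=
    2 / (1 - Cmod u) * ((INR n + 1) * Cmod u ^ n).
Proof.
  intros Hl Hu. assert (Hu0 := Cmod_ge_0 u).
  set (r := Cmod u) in *.
  assert (Hn := pos_INR n).
  set (K := 2 / (1 - r) * ((INR n + 1) * r ^ n)).
  assert (Hpow : 0 <= r ^ n) by now apply pow_le.
  assert (Hq : 0 < / (1 - r)) by (apply Rinv_0_lt_compat; lra).
  assert (HK : 0 <= K).
  { unfold K, Rdiv. apply Rmult_le_pos; [lra|]. apply Rmult_le_pos; lra. }
  assert (H := Cmod_le_majorant
    (fun w => binom_sum lam n w * Cpower (1 - w) lam)%C
    (fun w => - (RtoC ((lam + INR n) * binom_coef lam n) * w ^ n) *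
                (Cpower (1 - w) lam * / (1 - w)))%C
    (fun w => RtoC K * w)%C (fun _ => RtoC K) u).
  cbv beta in H.
  rewrite binom_sum_at_0 in H. replace (1 - 0)%C with (RtoC 1) in H by ring.
  assert (E : Cpower 1 lam = RtoC 1).
  { unfold Cpower. rewrite Clog_RtoC, ln_1, Cmult_0_r by lra. apply Cexp_0. }
  rewrite E, Cmult_1_r in H. eapply Rle_trans; [apply H|].
  - intros w Hw. assert (Hw1 : Cmod w < 1) by (fold r in Hw; lra).
    assert (Hz := Re_pos_nz _ (Re_one_minus_pos w Hw1)).
    eapply Cderiv_eq.
    + apply Cderiv_mult; [apply Cderiv_binom_sum | now apply Cderiv_Cpower_one_minus].
    + cbv beta. set (p := Cpower _ _).
      transitivity (((1 - w) * binom_sum' lam n w - RtoC lam * binom_sum lam n w)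
                    * (p * / (1 - w)))%C; [field; assumption|].
      rewrite binom_sum_ode. ring.
  - intros w Hw. eapply Cderiv_eq; [apply Cderiv_scal, Cderiv_id | ring].
  - intros w Hw. fold r in Hw. assert (Hw1 : Cmod w < 1) by lra.
    assert (Hw0 := Cmod_ge_0 w).
    assert (Hz := Re_pos_nz _ (Re_one_minus_pos w Hw1)).
    assert (Hc := binom_coef_pos lam n (proj1 Hl)).
    assert (Hc1 := binom_coef_le_1 lam n Hl).
    assert (Hcp : 0 <= (lam + INR n) * binom_coef lam n) by (apply Rmult_le_pos; lra).
    rewrite re_RtoC, Cmod_mult, Cmod_opp, Cmod_mult, Cmod_R, Cmod_pow, Cmod_mult, Cmod_inv,
      Rabs_pos_eq by assumption.
    assert (Hlow : 1 - r <= Cmod (1 - w)).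
    { assert (T := Cmod_triangle (1 - w) w). replace (1 - w + w)%C with (RtoC 1) in T by ring.
      rewrite Cmod_1 in T. lra. }
    assert (Hup : Cmod (1 - w) <= 2).
    { unfold Cminus. eapply Rle_trans; [apply Cmod_triangle|]. rewrite Cmod_opp, Cmod_1. lra. }
    assert (HP : Cmod (Cpower (1 - w) lam) <= 2).
    { unfold Cpower. rewrite Cmod_Cexp, re_scal_l. simpl Re.
      rewrite <- (exp_ln 2) by lra. apply exp_le.
      assert (L2 : 0 <= ln 2) by (rewrite <- ln_1; apply ln_le; lra).
      assert (L : ln (Cmod (1 - w)) <= ln 2) by (apply ln_le; lra).
      nra. }
    assert (HI : / Cmod (1 - w) <= / (1 - r)) by (apply Rinv_le_contravar; lra).
    unfold K. rewrite Rmult_comm. apply Rmult_le_compat.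
    + apply Rmult_le_pos; [apply Cmod_ge_0 | left; apply Rinv_0_lt_compat; lra].
    + apply Rmult_le_pos; [assumption | now apply pow_le].
    + apply Rmult_le_compat; try assumption; [apply Cmod_ge_0 | left; apply Rinv_0_lt_compat; lra].
    + apply Rmult_le_compat; [assumption | now apply pow_le | nra | now apply pow_incr].
  - fold r. rewrite Cmult_0_r, <- RtoC_mult, !re_RtoC. nra.
Qed.

(** Each of the [n + 1] terms of [1 + y + ... + y^n] is at least [y^n], and [1 - y] times this sum
    is [1 - y^(n+1)]. *)
Lemma succ_mult_pow_le (y : R) (n : nat) :
  0 <= y <= 1 -> (INR n + 1) * y ^ n * (1 - y) <= 1 - y ^ S n.
Proof.
  intros Hy. induction n as [|n IH]; [simpl; lra|].
  rewrite S_INR. simpl in *.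
  assert (Hp : 0 <= y ^ n) by now apply pow_le.
  assert (Hp1 : y ^ n <= 1) by (rewrite <- (pow1 n); now apply pow_incr).
  apply Rmult_le_compat_l with (r := y) in IH; [|lra].
  assert (y * y ^ n <= 1) by nra. nra.
Qed.

Lemma is_lim_seq_succ_mult_pow (r : R) :
  0 <= r < 1 -> is_lim_seq (fun n => (INR n + 1) * r ^ n) 0.
Proof.
  (* Of the two factors [y ^ n] in [r ^ n], one absorbs [n + 1] and the other tends to [0]. *)
  intros Hr. set (y := sqrt r).
  assert (Hy0 : 0 <= y) by apply sqrt_pos.
  assert (Hyy : y * y = r) by (apply sqrt_sqrt; lra).
  assert (Hy1 : y < 1) by nra.
  apply (is_lim_seq_le_le (fun _ => 0) _ (fun n => / (1 - y) * y ^ n)).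
  - intros n. assert (Hn := pos_INR n).
    assert (Hp : 0 <= y ^ n) by now apply pow_le.
    assert (Hq : 0 < / (1 - y)) by (apply Rinv_0_lt_compat; lra).
    rewrite <- Hyy, Rpow_mult_distr. split; [apply Rmult_le_pos; nra|].
    assert (H := succ_mult_pow_le y n ltac:(lra)).
    assert (Hs : 0 <= y ^ S n) by now apply pow_le.
    assert (H' : (INR n + 1) * y ^ n <= / (1 - y)).
    { apply Rmult_le_reg_r with (1 - y); [lra|]. rewrite Rinv_l; lra. }
    rewrite <- Rmult_assoc. now apply Rmult_le_compat_r.
  - apply is_lim_seq_const.
  - replace (Finite 0) with (Rbar_mult (/ (1 - y)) 0) by (simpl; now rewrite Rmult_0_r).
    apply is_lim_seq_scal_l, is_lim_seq_geom. rewrite Rabs_pos_eq; lra.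
Qed.

(** Discs in the modulus lie inside the balls of the product structure on [C], so convergence in
    modulus is enough. *)
Lemma is_pseries_C_intro (a : nat -> C) (z l : C) :
  is_lim_seq (fun n => Cmod (partial_sum a n z - l)) 0 ->
  @is_pseries C_AbsRing C_NormedModule a z l.
Proof.
  intros H. apply (filterlim_locally (U := C_UniformSpace)). intros eps.
  apply is_lim_seq_spec in H. destruct (H eps) as [N HN].
  exists N. intros n Hn. apply C_NormedModule_mixin_compat1.
  specialize (HN n Hn). rewrite Rminus_0_r, Rabs_pos_eq in HN by apply Cmod_ge_0.
  assert (E : partial_sum a n z =
    sum_n (fun k => @scal C_AbsRing C_NormedModule (pow_n z k) (a k)) n).
  { apply sum_n_ext. intros k. apply (Cmult_comm (a k) (z ^ k)). }
  rewrite E in HN. exact HN.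
Qed.

(** * The substitution [u = - B z] and the theorem *)

Lemma v0_eq (lam B : R) (z : C) : v0 lam B z = (/ Cpower (1 - RtoC (- B) * z) lam)%C.
Proof. unfold v0. do 2 f_equal. rewrite RtoC_opp. ring. Qed.

(** Being an exponential, [Cpower] vanishes nowhere, even at [w = 0]. Hence the identities for [v0]
    hold for all [z], as [analytic_on_disc_ext] demands. *)
Lemma Cpower_nz (w : C) (s : R) : Cpower w s <> RtoC 0.
Proof. apply Cexp_nz. Qed.

Lemma Cinv_involutive (w : C) : w <> RtoC 0 -> (/ / w)%C = w.
Proof. intros Hw. now field. Qed.

Lemma Cinv_v0 (lam B : R) (z : C) : (/ v0 lam B z)%C = Cpower (1 - RtoC (- B) * z) lam.
Proof. rewrite v0_eq. apply Cinv_involutive, Cpower_nz. Qed.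

Lemma Cmod_neg_mult (B : R) (z : C) : -1 <= B < 0 -> Cmod (RtoC (- B) * z) = - B * Cmod z.
Proof. intros HB. rewrite Cmod_mult, Cmod_R, Rabs_pos_eq; lra. Qed.

Lemma Cmod_neg_mult_lt_1 (B : R) (z : C) :
  -1 <= B < 0 -> in_disc z -> Cmod (RtoC (- B) * z) < 1.
Proof.
  unfold in_disc. intros HB Hz. rewrite Cmod_neg_mult by assumption.
  assert (H := Cmod_ge_0 z). nra.
Qed.

Lemma Cderiv_comp_scal (f : C -> C) (a z l : C) :
  Cderiv f (a * z)%C l -> Cderiv (fun w => f (a * w)%C) z (a * l)%C.
Proof.
  intros H. apply (Cderiv_comp f (fun w => a * w)%C); [exact H|].
  eapply Cderiv_eq; [apply Cderiv_scal, Cderiv_id | ring].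
Qed.

Lemma analytic_on_disc_ext (f g : C -> C) :
  (forall z, f z = g z) -> analytic_on_disc f -> analytic_on_disc g.
Proof.
  intros E H z Hz.
  exact (ex_derive_ext (K := C_AbsRing) (V := C_NormedModule) f g z E (H z Hz)).
Qed.

Lemma class_A1_v0 (lam B : R) : -1 <= B < 0 -> class_A1 (v0 lam B).
Proof.
  intros HB. split.
  (* The reciprocal becomes a power with exponent [- lam], and [Cderiv_Cpower_one_minus] allows any
     real exponent. *)
  - apply (analytic_on_disc_ext (fun z => Cpower (1 - RtoC (- B) * z) (- lam))).
    { intros z. rewrite v0_eq. unfold Cpower. rewrite Cinv_Cexp, RtoC_opp. f_equal. ring. }
    intros z Hz. eapply Cderiv_ex_derive.
    apply (Cderiv_comp_scal (fun w => Cpower (1 - w) (- lam))).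
    now apply Cderiv_Cpower_one_minus, Cmod_neg_mult_lt_1.
  - rewrite v0_eq, Cmult_0_r. replace (1 - 0)%C with (RtoC 1) by ring.
    unfold Cpower. rewrite Clog_RtoC, ln_1, Cmult_0_r, Cexp_0 by lra. field.
Qed.

Lemma partial_sum_scaled (lam B : R) (n : nat) (z : C) :
  partial_sum (fun k => RtoC (binom_coef lam k * (- B) ^ k)) n z =
  binom_sum lam n (RtoC (- B) * z).
Proof.
  apply sum_n_ext. intros k.
  rewrite RtoC_mult, RtoC_pow, Cpow_mult_l. symmetry. apply Cmult_assoc.
Qed.

Lemma power_series_v0 (lam B : R) :
  0 < lam <= 1 -> -1 <= B < 0 ->
  power_series_on_disc (v0 lam B) (fun k => RtoC (binom_coef lam k * (- B) ^ k)).
Proof.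
  intros Hl HB z Hz. apply is_pseries_C_intro.
  assert (Hu := Cmod_neg_mult_lt_1 B z HB Hz).
  set (u := (RtoC (- B) * z)%C) in *.
  (* The error of the partial sum is [v0 lam B z] times the deviation from [1] already estimated;
     [K] is independent of [n]. *)
  set (K := Cmod (v0 lam B z) * (2 / (1 - Cmod u))).
  apply (is_lim_seq_le_le (fun _ => 0) _ (fun n => K * ((INR n + 1) * Cmod u ^ n))).
  - intros n. split; [apply Cmod_ge_0|].
    rewrite partial_sum_scaled. fold u.
    replace (binom_sum lam n u - v0 lam B z)%C
      with (v0 lam B z * (binom_sum lam n u * Cpower (1 - u) lam - 1))%C.
    + rewrite Cmod_mult. unfold K. rewrite Rmult_assoc.
      apply Rmult_le_compat_l; [apply Cmod_ge_0|].
      now apply Cmod_binom_sum_Cpower_minus_1.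
    + rewrite v0_eq. fold u. field. apply Cpower_nz.
  - apply is_lim_seq_const.
  - replace (Finite 0) with (Rbar_mult K 0) by (simpl; now rewrite Rmult_0_r).
    apply is_lim_seq_scal_l, is_lim_seq_succ_mult_pow. split; [apply Cmod_ge_0 | assumption].
Qed.

Theorem corollary1 : forall lambda B : R,
  0 < lambda <= 1 -> -1 <= B < 0 -> stable (v0 lambda B).
Proof.
  intros lam B Hl HB n _.
  assert (HA := class_A1_v0 lam B HB).
  split; [exact HA|]. split; [exact HA|].
  exists (fun k => RtoC (binom_coef lam k * (- B) ^ k)).
  split; [now apply power_series_v0|].
  assert (Ef : forall z, (binom_sum lam n (RtoC (- B) * z) * Cpower (1 - RtoC (- B) * z) lam)%C =
      (partial_sum (fun k => RtoC (binom_coef lam k * (- B) ^ k)) n z / v0 lam B z)%C).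
  { intros z. unfold Cdiv. now rewrite Cinv_v0, partial_sum_scaled. }
  assert (HB0 : RtoC (- B) <> RtoC 0) by (intros E; apply RtoC_inj in E; lra).
  split; [|split].
  - apply (analytic_on_disc_ext _ _ Ef). intros z Hz. eapply Cderiv_ex_derive.
    apply (Cderiv_comp_scal (fun u => binom_sum lam n u * Cpower (1 - u) lam)%C).
    apply Cderiv_mult; [apply Cderiv_binom_sum|].
    now apply Cderiv_Cpower_one_minus, Cmod_neg_mult_lt_1.
  - apply (analytic_on_disc_ext (fun z => Cpower (1 - RtoC (- B) * z) lam)).
    { intros z. symmetry. apply Cinv_v0. }
    intros z Hz. eapply Cderiv_ex_derive.
    apply (Cderiv_comp_scal (fun w => Cpower (1 - w) lam)).
    now apply Cderiv_Cpower_one_minus, Cmod_neg_mult_lt_1.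
  (* [/ v0] multiplies its argument by [- B] again. Dividing by [- B] is harmless because
     [schwarz_fun] is bounded by [Cmod u], not merely by [1]. *)
  - exists (fun z => / RtoC (- B) * schwarz_fun lam n (RtoC (- B) * z))%C.
    split; [|split; [|split]].
    + intros z Hz. eapply Cderiv_ex_derive. apply Cderiv_scal.
      apply (Cderiv_comp_scal (schwarz_fun lam n)).
      apply Cderiv_schwarz_fun; [assumption | now apply Cmod_neg_mult_lt_1].
    + rewrite Cmult_0_r, schwarz_fun_0. ring.
    + intros z Hz. eapply Rle_lt_trans; [|exact Hz].
      assert (H := Cmod_schwarz_fun_le lam n _ Hl (Cmod_neg_mult_lt_1 B z HB Hz)).
      rewrite Cmod_neg_mult in H by assumption.
      rewrite Cmod_mult, Cmod_inv, Cmod_R, Rabs_pos_eq by (assumption || lra).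
      apply Rmult_le_reg_l with (- B); [lra|].
      rewrite <- Rmult_assoc, Rinv_r, Rmult_1_l by lra. exact H.
    + intros z Hz. rewrite <- Ef, Cinv_v0, Cmult_assoc, Cinv_r, Cmult_1_l by assumption.
      symmetry. apply Cpower_one_minus_schwarz_fun; [assumption | now apply Cmod_neg_mult_lt_1].
Qed.
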